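(* Let $H$ be a complex Hilbert space. The set $GL_{S}^{+}(H)$ of positive isomorphisms in $L(H)$, viewed as a subset of the real Banach space $L_{S}(H)$ of self-adjoint operators, is a differentiable real Banach manifold, and its tangent space at every $L\in GL_{S}^{+}(H)$ satisfies $T_{L}GL_{S}^{+}(H)\cong L_{S}(H)$.
   Context: $L(H)$ is the Banach space of bounded linear operators $H\to H$ with the operator norm. $L_{S}(H)$ is the set of self-adjoint operators in $L(H)$, regarded as a real vector space with the norm inherited from $L(H)$; it is a real Banach space. An operator is an isomorphism if it is bijective with bounded inverse. A self-adjoint operator $L\in L(H)$ is called positive if $\langle Lx,x\rangle>0$ for all $x\in H$ with $\Vert x\Vert=1$. $GL_{S}^{+}(H)$ denotes the set of $L\in L(H)$ that are self-adjoint, positive and isomorphisms. The manifold structure is the one $GL_{S}^{+}(H)$ carries as an open subset of $L_{S}(H)$. *)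

(* Defs.v *)
From HB Require Import structures.
From mathcomp Require Import all_boot all_order all_algebra sesquilinear.
From mathcomp Require Import complex.
From mathcomp Require Import all_classical all_reals all_analysis.

Set Implicit Arguments.
Unset Strict Implicit.
Unset Printing Implicit Defensive.

Import Order.TTheory GRing.Theory Num.Theory.
Import numFieldNormedType.Exports.

Local Open Scope classical_set_scope.
Local Open Scope ring_scope.
Local Open Scope complex_scope.

(* The scalar field [K] is either a [realType] or its complexification.  All that
the operator norm needs is that bounded sets of nonnegative elements of [K]
have least upper bounds, for the (partial, when [K] is complex) order of [K].
The type [bop] takes the proof [hK] of this as a parameter only so that the
canonical norm can refer to it. *)

Definition nonneg_lub (K : numFieldType) : Prop :=
  forall A : set K, A !=set0 -> (forall a, A a -> 0 <= a) ->
    has_ubound A -> supremums A !=set0.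

Lemma nonneg_lub_real (R : realType) : nonneg_lub R.
Proof.
move=> A A0 _ Aub; exists (sup A); split.
  by apply: ub_le_sup.
by move=> b ub_b; apply: ge_sup.
Qed.

Lemma nonneg_lub_complex (R : realType) : nonneg_lub R[i].
Proof.
move=> A [a0 Aa0] Age0 [ub Aub].
have imA a : A a -> complex.Im a = 0.
  by move=> /Age0; rewrite lecE => /andP[/eqP-> _].
have ubIm b : ubound A b -> complex.Im b = 0.
  by move=> /(_ _ Aa0); rewrite lecE => /andP[/eqP-> _]; exact: imA.
have ubRe b : ubound A b -> ubound (@complex.Re R @` A) (complex.Re b).
  by move=> Ab _ [a Aa <-]; have := Ab _ Aa; rewrite lecE => /andP[].
exists (sup (@complex.Re R @` A))%:C; split.
  move=> a Aa; rewrite lecE /= (imA _ Aa) eqxx /=.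
  by apply: (ub_le_sup (ex_intro _ (complex.Re ub) (ubRe _ Aub))); exists a.
move=> b Ab; rewrite lecE /= (ubIm _ Ab) eqxx /=.
by apply: ge_sup; [exists (complex.Re a0), a0 | exact: ubRe].
Qed.

Definition bop_pred (K : numFieldType) (E F : normedModType K) : {pred E -> F} :=
  [pred f : E -> F | `[< linear f /\ continuous f >]].
Arguments bop_pred {K} E F.

Record bop (K : numFieldType) (hK : nonneg_lub K) (E F : normedModType K) :=
  Bop { bop_fun :> E -> F; _ : bop_fun \in bop_pred E F }.

Section BoundedOperators.
Context (K : numFieldType) (hK : nonneg_lub K) (E F : normedModType K).
Local Notation bop := (bop hK E F).
Local Notation bop_pred := (bop_pred E F).

HB.instance Definition _ := [isSub for @bop_fun K hK E F].
HB.instance Definition _ := [Choice of bop by <:].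

Lemma bop_submod_closed : submod_closed bop_pred.
Proof.
split.
  rewrite unfold_in /=; apply: asboolT; split; last by move=> x; exact: cvg_cst.
  by move=> a x y; change (0 = a *: 0 + 0 :> F); rewrite scaler0 addr0.
move=> a f g; rewrite !unfold_in /= => /asboolW[lf cf] /asboolW[lg cg].
apply: asboolT; split=> [b x y|x].
  change (a *: f (b *: x + y) + g (b *: x + y) =
          b *: (a *: f x + g x) + (a *: f y + g y)).
  by rewrite lf lg !scalerDr !scalerA [a * b]mulrC addrACA.
by apply: cvgD; [apply: cvgZr; exact: cf | exact: cg].
Qed.

HB.instance Definition _ :=
  GRing.isSubmodClosed.Build K (E -> F) bop_pred bop_submod_closed.
HB.instance Definition _ := [SubChoice_isSubLmodule of bop by <:].

Lemma bop_linear (T : bop) : linear T.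
Proof. by case: T => f /= /asboolP[]. Qed.

Lemma bop_continuous (T : bop) : continuous T.
Proof. by case: T => f /= /asboolP[]. Qed.

HB.instance Definition _ (T : bop) :=
  GRing.isLinear.Build K E F _ T (bop_linear T).

Lemma bopDE (S T : bop) x : (S + T) x = S x + T x. Proof. by []. Qed.
Lemma bopZE a (T : bop) x : (a *: T) x = a *: T x. Proof. by []. Qed.
Lemma bopBE (S T : bop) x : (S - T) x = S x - T x. Proof. by []. Qed.

Definition opnorm (T : bop) : K :=
  supremum 0 [set `|T x| | x in [set x | `|x| <= 1]].

Lemma bop_bounded (T : bop) : exists M, forall x, `|T x| <= M * `|x|.
Proof.
pose f : {linear E -> F} := T.
have /(linear_bounded_continuous f) : continuous f by exact: bop_continuous.
by move=> /linear_boundedP/pinfty_ex_gt0[M _ HM]; exists M.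
Qed.

Lemma opnorm_lub (T : bop) :
  supremums [set `|T x| | x in [set x | `|x| <= 1]] (opnorm T).
Proof.
have A0 : [set `|T x| | x in [set x | `|x| <= 1]] !=set0.
  by exists `|T 0|, 0 => //=; rewrite normr0.
have [m Hm] : supremums [set `|T x| | x in [set x | `|x| <= 1]] !=set0.
  apply: hK => //; first by move=> _ [x _ <-].
  have [M HM] := bop_bounded T.
  exists `|M| => _ [x /= x1 <-]; apply: le_trans (HM x) _.
  have [->|x0] := eqVneq x 0; first by rewrite normr0 mulr0.
  have M0 : 0 <= M.
    by rewrite -(@pmulr_lge0 _ `|x|) ?normr_gt0// (le_trans _ (HM x)).
  by rewrite (ger0_norm M0) ler_piMr.
rewrite /opnorm /supremum ifF; first by case: xgetP => // /(_ m).
by apply/negbTE/set0P.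
Qed.

Lemma opnorm_ub (T : bop) M :
  (forall x, `|x| <= 1 -> `|T x| <= M) -> opnorm T <= M.
Proof. by have [_ H] := opnorm_lub T; move=> HM; apply: H => _ [x /HM ? <-]. Qed.

Lemma opnorm_ge0 (T : bop) : 0 <= opnorm T.
Proof.
have [H _] := opnorm_lub T; apply: le_trans (normr_ge0 (T 0)) (H _ _).
by exists 0 => //=; rewrite normr0.
Qed.

Lemma opnormP (T : bop) x : `|T x| <= opnorm T * `|x|.
Proof.
have [->|x0] := eqVneq x 0; first by rewrite linear0 !normr0 mulr0.
have nx : 0 < `|x| by rewrite normr_gt0.
have [H _] := opnorm_lub T.
have : `|T (`|x|^-1 *: x)| <= opnorm T.
  by apply: H; exists (`|x|^-1 *: x) => //=; rewrite normfZV.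
by rewrite linearZ normrZ normfV normr_id mulrC ler_pdivrMr.
Qed.

Lemma opnormD (S T : bop) : opnorm (S + T) <= opnorm S + opnorm T.
Proof.
apply: opnorm_ub => x x1; rewrite bopDE; apply: le_trans (ler_normD _ _) _.
by apply: lerD; apply: le_trans (opnormP _ _) _; rewrite ler_piMr ?opnorm_ge0.
Qed.

Lemma opnormZ_le a (T : bop) : opnorm (a *: T) <= `|a| * opnorm T.
Proof.
apply: opnorm_ub => x x1; rewrite bopZE normrZ ler_wpM2l//.
by apply: le_trans (opnormP _ _) _; rewrite ler_piMr ?opnorm_ge0.
Qed.

Lemma opnorm_eq0 (T : bop) : opnorm T = 0 -> T = 0.
Proof.
move=> T0; apply/val_inj/funext => x /=; apply/eqP.
by rewrite -normr_le0 (le_trans (opnormP T x))// T0 mul0r.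
Qed.

Lemma opnormZ a (T : bop) : opnorm (a *: T) = `|a| * opnorm T.
Proof.
apply/le_anti; rewrite opnormZ_le /=.
have [->|a0] := eqVneq a 0; first by rewrite normr0 mul0r opnorm_ge0.
rewrite -ler_pdivlMl ?normr_gt0// -normfV.
by apply: le_trans (opnormZ_le _ _); rewrite scalerA mulVf// scale1r.
Qed.

HB.instance Definition _ :=
  Lmodule_isNormed.Build K bop opnormD opnormZ opnorm_eq0.

End BoundedOperators.

Section BoundedOperatorsComplete.
Context (K : numFieldType) (hK : nonneg_lub K).
Context (E : normedModType K) (F : completeNormedModType K).

Lemma bop_norm_le (T : bop hK E F) M :
  0 <= M -> (forall x, `|T x| <= M * `|x|) -> `|T| <= M.
Proof.
move=> M0 HM; apply: opnorm_ub => x x1.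
by apply: le_trans (HM x) _; rewrite ler_piMr.
Qed.

Lemma bop_normP (T : bop hK E F) x : `|T x| <= `|T| * `|x|.
Proof. exact: opnormP. Qed.

Lemma bop_cauchy_cvg (G : set_system (bop hK E F)) :
  ProperFilter G -> cauchy G -> cvg G.
Proof.
move=> PG cG.
have small e : 0 < e -> exists2 A, G A & forall S T, A S -> A T -> `|S - T| <= e.
  move=> e0; have [T0 /= HT] : exists T, G (ball T (e / 2)).
    by move/cauchyP : cG => /(_ (e / 2)); apply; rewrite divr_gt0.
  exists (ball T0 (e / 2)) => // S T; rewrite -!ball_normE /= => HS HT0.
  have -> : S - T = (T0 - T) - (T0 - S).
    by rewrite opprB [RHS]addrC addrA subrK.
  rewrite (splitr e) (le_trans (ler_normB _ _))//.
  by apply: lerD; apply: ltW.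
have cvgx x : cvg ((T x) @[T --> G]).
  apply: cauchy_cvg; apply: cauchy_exP => e e0.
  have d0 : 0 < e / (1 + `|x|) by rewrite divr_gt0// ltr_pwDl.
  have [A GA HA] := small _ d0.
  have [S AS] := filter_ex GA.
  exists (S x); change (G [set T : bop hK E F | ball (S x) e (T x)]).
  apply: filterS GA => T AT; rewrite -ball_normE /=.
  change (`|(S - T) x| < e); rewrite (le_lt_trans (bop_normP _ _))//.
  rewrite (le_lt_trans (ler_wpM2r _ (HA _ _ AS AT)))//.
  by rewrite mulrAC ltr_pdivrMr ?ltr_pwDl// ltr_pM2l// ltrDr.
pose g x := lim ((T x) @[T --> G]).
have gP x : (T x) @[T --> G] --> g x by exact: cvgx.
have close e : 0 < e ->
    exists2 A, G A & forall T, A T -> forall x, `|g x - T x| <= e * `|x|.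
  move=> e0; have [A GA HA] := small _ e0.
  exists A => // T AT x.
  apply/ler_addgt0Pr => d d0.
  have [S AS gS] : exists2 S, A S & `|g x - S x| <= d.
    have GB : G [set S : bop hK E F | `|g x - S x| <= d].
      by move/cvgrPdist_le : (gP x); apply.
    by have [S [AS BS]] := filter_ex (filterI GA GB); exists S.
  rewrite -[g x](subrK (S x)) -addrA addrC (le_trans (ler_normD _ _))//.
  apply: lerD => //; change (`|(S - T) x| <= e * `|x|).
  by rewrite (le_trans (bop_normP _ _))// ler_wpM2r// HA.
have lg : linear g.
  move=> a x y.
  have c1 : (a *: T x + T y) @[T --> G] --> a *: g x + g y.
    by apply: cvgD; [apply: cvgZr; exact: gP | exact: gP].
  have -> : a *: g x + g y = lim ((a *: T x + T y) @[T --> G]).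
    by apply/esym/cvg_lim.
  rewrite /g; congr (lim (_ @ G)); apply/funext => T.
  exact: bop_linear.
have cg : continuous g.
  have [A GA HA] := close 1 ltr01.
  have [T AT] := filter_ex GA.
  pose gl : {linear E -> F} := HB.pack g (GRing.isLinear.Build K E F _ g lg).
  apply: (@bounded_linear_continuous _ _ _ gl).
  apply/linear_boundedP; near=> M => x.
  rewrite -[gl x](subrK (T x)) (le_trans (ler_normD _ _))//.
  rewrite (le_trans (lerD (HA _ AT x) (bop_normP T x)))//.
  by rewrite -mulrDl ler_wpM2r.
have gin : g \in bop_pred E F by rewrite unfold_in; apply: asboolT.
apply/cvg_ex; exists (Bop hK gin); apply/cvgrPdist_le => /= e e0.
have [A GA HA] := close _ e0.
apply: filterS GA => T AT; apply: bop_norm_le; first exact: ltW.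
by move=> x; exact: HA.
Unshelve. all: by end_near. Qed.

HB.instance Definition _ :=
  Uniform_isComplete.Build (bop hK E F) bop_cauchy_cvg.

End BoundedOperatorsComplete.

(* The inner product is linear in its first argument. *)
Record hilbertType (R : realType) := Hilbert {
  hilbert_space :> completeNormedModType R[i];
  inner : {dot hilbert_space for Num.conj};
  inner_norm : forall x : hilbert_space, `|x| ^+ 2 = inner x x
}.
Arguments inner {R H} : rename.

Section InnerProduct.
Context (R : realType) (H : hilbertType R).
Implicit Types u v : H.

Lemma inner_CauchySchwarz u v : `|inner u v| <= `|u| * `|v|.
Proof.
have [->|v0] := eqVneq v 0; first by rewrite linear0r !normr0 mulr0.
have nv : 0 < `|v| by rewrite normr_gt0.
set d := inner u v; set n := `|v| ^+ 2.
have n0 : 0 < n by rewrite exprn_gt0.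
have nE : inner v v = n by rewrite /n inner_norm.
have cn : Num.conj n = n by rewrite geC0_conj// ltW.
have : 0 <= inner (u - (d / n) *: v) (u - (d / n) *: v) by exact: dnorm_ge0.
have -> : inner (u - (d / n) *: v) (u - (d / n) *: v) =
    `|u| ^+ 2 + `|d / n| ^+ 2 * n - (`|d| ^+ 2 / n + Num.conj (`|d| ^+ 2 / n)).
  have dE : inner u ((d / n) *: v) = `|d| ^+ 2 / n.
    rewrite [LHS]linearZr_LR /= -/d rmorphM /= fmorphV /= cn.
    by rewrite mulrAC -normCKC.
  by rewrite dnormB dnormZ nE dE inner_norm.
rewrite normrM exprMn normfV (gtr0_norm n0).
have -> : `|d| ^+ 2 * n^-1 ^+ 2 * n = `|d| ^+ 2 / n.
  by rewrite expr2 -!mulrA mulVf ?mulr1// gt_eqF.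
rewrite rmorphM /= fmorphV /= cn (geC0_conj (exprn_ge0 _ (normr_ge0 _))).
rewrite opprD addrA addrK subr_ge0 ler_pdivrMr// -exprMn.
by rewrite ler_sqr ?nnegrE ?mulr_ge0.
Qed.

End InnerProduct.

(* L(H) *)
Notation operator H := (bop (@nonneg_lub_complex _) H H).

Section SelfAdjoint.
Context (R : realType) (H : hilbertType R).
Implicit Types T : operator H.

Definition selfadjoint T := forall x y : H, inner (T x) y = inner x (T y).

Definition isomorphism T :=
  exists S : operator H, cancel T S /\ cancel S T.

(* [0 < z] in [R[i]] means that [z] is real and positive. *)
Definition positive_op T :=
  selfadjoint T /\ forall x : H, `|x| = 1 -> 0 < inner (T x) x.

Definition sa_pred : {pred operator H} := [pred T | `[< selfadjoint T >]].

(* L_S(H) *)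
Record sa_operator := SaOperator { sa_val :> operator H; _ : sa_val \in sa_pred }.

HB.instance Definition _ := [isSub for sa_val].
HB.instance Definition _ := [Choice of sa_operator by <:].

Lemma sa_operatorP (T : sa_operator) : selfadjoint T.
Proof. by case: T => T /= /asboolP. Qed.

Lemma sa_predP T : reflect (selfadjoint T) (T \in sa_pred).
Proof. exact: asboolP. Qed.

Lemma sa_zmod_closed : zmod_closed sa_pred.
Proof.
split; first by apply/sa_predP => x y; rewrite linear0l linear0r.
move=> S T /sa_predP hS /sa_predP hT; apply/sa_predP => x y.
rewrite !bopBE linearBl linearBr.
by congr (_ - _); [exact: hS | exact: hT].
Qed.

HB.instance Definition _ :=
  GRing.isZmodClosed.Build (operator H) sa_pred sa_zmod_closed.
HB.instance Definition _ := [SubChoice_isSubZmodule of sa_operator by <:].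

Lemma sa_scale_closed (r : R) (T : sa_operator) : r%:C *: sa_val T \in sa_pred.
Proof.
apply/sa_predP => x y; rewrite !bopZE linearZl_LR linearZr /= sa_operatorP.
by congr (_ * _); exact/esym/conjc_real.
Qed.

Definition sa_scale (r : R) (T : sa_operator) : sa_operator :=
  SaOperator (sa_scale_closed r T).

Lemma sa_scaleA (a b : R) (T : sa_operator) : sa_scale a (sa_scale b T) = sa_scale (a * b) T.
Proof. by apply: val_inj; rewrite /= scalerA rmorphM. Qed.
Lemma sa_scale1 : left_id 1 sa_scale.
Proof. by move=> T; apply: val_inj; rewrite /= scale1r. Qed.
Lemma sa_scaleDr : right_distributive sa_scale +%R.
Proof. by move=> a S T; apply: val_inj; rewrite /= scalerDr. Qed.
Lemma sa_scaleDl (T : sa_operator) : {morph sa_scale^~ T : a b / a + b}.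
Proof. by move=> a b; apply: val_inj; rewrite /= rmorphD scalerDl. Qed.

HB.instance Definition _ := GRing.Zmodule_isLmodule.Build R sa_operator
  sa_scaleA sa_scale1 sa_scaleDr sa_scaleDl.

(* The norm of [L(H)], which takes values in [R[i]], restricted to [L_S(H)]. *)
Definition sa_norm (T : sa_operator) : R := complex.Re `|sa_val T|.

Lemma sa_normE (T : sa_operator) : (sa_norm T)%:C = `|sa_val T|.
Proof. by rewrite RRe_real ?normr_real. Qed.

Lemma sa_normD (S T : sa_operator) : sa_norm (S + T) <= sa_norm S + sa_norm T.
Proof. by rewrite -lecR rmorphD /= !sa_normE ler_normD. Qed.
Lemma sa_normZ (r : R) (T : sa_operator) : sa_norm (r *: T) = `|r| * sa_norm T.
Proof.
apply: complexI; rewrite rmorphM /= !sa_normE normrZ; congr (_ * _).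
by rewrite normc_def /= expr0n addr0 sqrtr_sqr.
Qed.
Lemma sa_norm0_eq0 (T : sa_operator) : sa_norm T = 0 -> T = 0.
Proof.
by move=> T0; apply/val_inj/normr0_eq0; rewrite -sa_normE T0.
Qed.

HB.instance Definition _ := Lmodule_isNormed.Build R sa_operator
  sa_normD sa_normZ sa_norm0_eq0.

Lemma sa_normCE (T : sa_operator) : `|T|%:C = `|sa_val T|.
Proof. exact: sa_normE. Qed.

Lemma sa_cauchy_cvg (G : set_system sa_operator) :
  ProperFilter G -> cauchy G -> cvg G.
Proof.
move=> PG cG.
have cvgT : cvg (sa_val @ G).
  apply: cauchy_cvg; apply: cauchy_exP => e.
  rewrite ltcE /= => /andP[/eqP ie re].
  have eE : e = (complex.Re e)%:C by rewrite [LHS]complexE ie mulr0 addr0.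
  move/cauchyP : cG => /(_ _ re)[S GS]; exists (sa_val S).
  change (G [set T | ball (sa_val S) e (sa_val T)]).
  apply: filterS GS => T; rewrite -!ball_normE /= => ST.
  change (`|sa_val (S - T)| < e).
  by rewrite -sa_normCE eE ltcR.
set T := lim (sa_val @ G).
have GT e : 0 < e -> G [set S | `|T - sa_val S| <= e].
  by move=> e0; move/cvgrPdist_le : cvgT; apply.
have Tin : T \in sa_pred.
  apply/sa_predP => x y; apply/eqP; rewrite -subr_eq0 -normr_le0.
  apply/ler_addgt0Pr => e e0; rewrite add0r.
  pose c := 1 + (`|x| * `|y|) *+ 2.
  have c0 : 0 < c by rewrite ltr_pwDl// mulrn_wge0// mulr_ge0.
  have [S /= TS] := filter_ex (GT _ (divr_gt0 e0 c0)).
  have -> : inner (T x) y - inner x (T y) =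
            inner ((T - sa_val S) x) y - inner x ((T - sa_val S) y).
    transitivity (inner (T x) y - inner (S x) y - (inner x (T y) - inner x (S y))).
      rewrite (_ : inner (S x) y = inner x (S y)); last exact: sa_operatorP.
      by rewrite opprB addrA subrK.
    by congr (_ - _); [exact/esym/linearBl | exact/esym/linearBr].
  rewrite (le_trans (ler_normB _ _))//.
  have b1 : `|inner ((T - sa_val S) x) y| <= e / c * (`|x| * `|y|).
    rewrite (le_trans (inner_CauchySchwarz _ _))// mulrA ler_wpM2r//.
    by rewrite (le_trans (bop_normP _ _))// ler_wpM2r.
  have b2 : `|inner x ((T - sa_val S) y)| <= e / c * (`|x| * `|y|).
    rewrite (le_trans (inner_CauchySchwarz _ _))// mulrCA ler_wpM2l//.
    by rewrite (le_trans (bop_normP _ _))// ler_wpM2r.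
  rewrite (le_trans (lerD b1 b2))// -mulrDr -mulr2n mulrAC ler_pdivrMr//.
  by rewrite ler_wpM2l ?(ltW e0)// lerDr.
apply/cvg_ex; exists (SaOperator Tin); apply/cvgrPdist_le => /= e e0.
have e0' : 0 < e%:C by rewrite ltcR.
apply: filterS (GT _ e0') => S /= TS.
by rewrite -lecR sa_normCE.
Qed.

HB.instance Definition _ := Uniform_isComplete.Build sa_operator sa_cauchy_cvg.

(* GL_S^+(H), as a subset of L_S(H) *)
Definition GLSp : set sa_operator :=
  [set T | isomorphism T /\ positive_op T].

End SelfAdjoint.
Arguments sa_operator {R} H.
Arguments GLSp {R} H.

Section Smooth.
Context (R : realType).

Definition realop (E F : normedModType R) : normedModType R :=
  bop (@nonneg_lub_real R) E F.

(* The derivative of [f]; its value is irrelevant where ['d f x] is not bounded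
   linear, which never happens at a point of differentiability. *)
Definition Dmap (E F : normedModType R) (f : E -> F) : E -> realop E F :=
  fun x => insubd (0 : bop (@nonneg_lub_real R) E F) ('d f x : E -> F).

Lemma DmapE (E F : normedModType R) (f : E -> F) (x : E) :
  differentiable f x -> bop_fun (Dmap f x) = 'd f x :> (E -> F).
Proof.
case=> -[cf _].
have din : ('d f x : E -> F) \in bop_pred E F.
  by rewrite unfold_in; apply: asboolT; split=> //; exact: linearP.
by rewrite /Dmap /insubd insubT.
Qed.

Fixpoint Ck (k : nat) (E F : normedModType R) (U : set E) (f : E -> F) : Prop :=
  if k is k'.+1 then
    (forall x, U x -> differentiable f x) /\ Ck k' U (Dmap f)
  else forall x, U x -> {for x, continuous f}.

(* [U] is meant to be open. *)
Definition smooth_on (E F : normedModType R) (U : set E) (f : E -> F) :=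
  forall k, Ck k U f.

End Smooth.

Section Manifold.
Context (R : realType) (M : topologicalType) (E : completeNormedModType R).

(* The values of [chart_map] outside [chart_dom] are irrelevant. *)
Record chart := Chart { chart_dom : set M; chart_map : M -> E }.
Implicit Types (c d : chart) (A : set chart).

(* A homeomorphism from an open subset of [M] to an open subset of [E]. *)
Definition is_chart c :=
  [/\ open (chart_dom c),
      {in chart_dom c &, injective (chart_map c)},
      {within chart_dom c, continuous (chart_map c)} &
      forall V, open V -> V `<=` chart_dom c -> open (chart_map c @` V)].

Definition overlap c d : set E :=
  chart_map c @` (chart_dom c `&` chart_dom d).

(* [d \o c^-1] on [overlap c d]. *)
Definition transition c d : E -> E := fun y =>
  xget 0 [set z | exists x, [/\ chart_dom c x, chart_dom d x,
                                chart_map c x = y & chart_map d x = z]].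

Definition compatible c d :=
  smooth_on (overlap c d) (transition c d) /\
  smooth_on (overlap d c) (transition d c).

Definition is_atlas A :=
  [/\ forall c, A c -> is_chart c,
      forall x, exists2 c, A c & chart_dom c x &
      forall c d, A c -> A d -> compatible c d].

(* The smooth structure on [M] is the one generated by the atlas [A]. *)
Definition banach_manifold A := hausdorff_space M /\ is_atlas A.

(* The maximal atlas generated by [A]. *)
Definition maximal_atlas A : set chart :=
  [set c | is_chart c /\ forall d, A d -> compatible c d].

(* The tangent space at [p].  Tangent vectors are the equivalence classes of
pairs [(c, v)] of a chart at [p] and a vector [v] of the model space, for
[(c, v) ~ (d, w)] iff [w = D(d \o c^-1)(c p) v].  Such a class contains exactly
one vector for each chart at [p], so it is encoded as a function on the charts
at [p]; the vector space operations are then pointwise. *)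

Section Tangent.
Context (A : set chart) (p : M).

Definition chart_at : Type :=
  {c : chart | maximal_atlas A c /\ chart_dom c p}.

Definition tangent_pred : {pred chart_at -> E} :=
  [pred v : chart_at -> E | `[< forall c d : chart_at,
     v d = 'd (transition (sval c) (sval d)) (chart_map (sval c) p) (v c) >]].

Record tangent := Tangent {
  tangent_val :> chart_at -> E; _ : tangent_val \in tangent_pred }.

HB.instance Definition _ := [isSub for tangent_val].
HB.instance Definition _ := [Choice of tangent by <:].

Lemma tangent_submod_closed : submod_closed tangent_pred.
Proof.
split.
  rewrite unfold_in; apply: asboolT => c d.
  by change (0 = 'd (transition (sval c) (sval d))
                    (chart_map (sval c) p) 0 :> E); rewrite linear0.
move=> a v w; rewrite !unfold_in => /asboolW hv /asboolW hw.
apply: asboolT => c d.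
change (a *: v d + w d = 'd (transition (sval c) (sval d))
          (chart_map (sval c) p) (a *: v c + w c)).
by rewrite linearP (hv c d) (hw c d).
Qed.

HB.instance Definition _ :=
  GRing.isSubmodClosed.Build R (chart_at -> E) tangent_pred tangent_submod_closed.
HB.instance Definition _ := [SubChoice_isSubLmodule of tangent by <:].

(* The coarsest topology making all coordinates [v |-> v c] continuous.  As the
   coordinates differ by the toplinear isomorphisms [D(d \o c^-1)(c p)], it is
   the one transported from [E] by any one of them. *)
HB.instance Definition _ := Topological.copy tangent
  (initial_topology (tangent_val : tangent -> {ptws chart_at -> E})).

End Tangent.
End Manifold.

(* The manifold structure of an open subset [U] of a Banach space, given by the
   inclusion as its only chart. *)
Definition inclusion_atlas (R : realType) (E : completeNormedModType R)
    (U : set E) : set (chart U E) :=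
  [set Chart setT (@set_val E U)].
Arguments inclusion_atlas {R E} U.

Definition toplinear_isomorphic (R : realType)
    (V W : preTopologicalLmodType R) : Prop :=
  exists (f : {linear V -> W}) (g : {linear W -> V}),
    [/\ cancel f g, cancel g f, continuous f & continuous g].

(* Main.v *)
From HB Require Import structures.
Require Import Defs.
From mathcomp Require Import all_boot all_order all_algebra sesquilinear.
From mathcomp Require Import complex.
From mathcomp Require Import all_classical all_reals all_analysis.

(** An open subset of a Banach space [E] is a manifold with the inclusion as its
only chart, and for any atlas the tangent space at [p] is identified with the
model space by reading tangent vectors in one chart at [p].  So the real content
is that the positive isomorphisms form an open subset of [L_S(H)].

Openness.  If [L] is positive with inverse [S], then [L] is coercive:
[<Lx, x> >= c |x|^2] for some [c > 0] ([positive_iso_coercive]).  Indeed, with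
[M > |L|], expanding [0 <= <L z, z>] at [z = x - M^-1 L x] gives
[|L x|^2 <= M <Lx, x>], while [|x| <= |S| |L x|].  A self-adjoint [T] with
[|T - L| < c] is then positive ([coercive_perturb]), and it is an isomorphism as
soon as [|S| |T - L| <= 1/2] ([perturb_inverse]).  The latter is the Neumann
series argument in the following form: correcting [x] by [S (y - T x)] halves
the residual, so [T] has dense range, and [T] is bounded below, hence has closed
range and a bounded inverse.

Tangent space.  Fix a chart [c] of the atlas at [p].  A tangent vector is
determined by its coordinate in [c], and any [w] in [E] is the coordinate of the
family [d |-> D(d \o c^-1)(c p) w].  That this family is a tangent vector is the
chain rule for transition maps; two charts of the maximal atlas are only known
to be compatible with the charts of the atlas, but their transition map factors
through [c] near [p] ([transition_comp]).  Both maps are continuous since the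
topology of the tangent space is the initial one for the coordinates. *)

Set Implicit Arguments.
Unset Strict Implicit.
Unset Printing Implicit Defensive.

Import Order.TTheory GRing.Theory Num.Theory.
Import numFieldNormedType.Exports.

Local Open Scope classical_set_scope.
Local Open Scope ring_scope.
Local Open Scope complex_scope.

(** * Derivatives of locally prescribed functions *)

Section Calculus.
Context {R : realType}.

(** The derivative ['d f x] is chosen among linear maps, so that its locality has
to come from the uniqueness [diff_unique]. *)
Lemma near_eq_diff (V W : normedModType R) (f g : V -> W) (x : V) :
  (\forall y \near x, f y = g y) -> differentiable g x ->
  differentiable f x /\ 'd f x = 'd g x :> (V -> W).
Proof.
move=> fg dg.
have fgx : f x = g x by exact: nbhs_singleton fg.
have fo : f \o shift x = cst (f x) + 'd g x +o_ 0 id.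
  apply/eqaddoP => e e0.
  have /eqaddoP/(_ e e0) := diff_locally dg.
  have : \forall h \near (0 : V), f (h + x) = g (h + x).
    by have := fg; rewrite (near_shift 0) subr0; apply: filterS => h /=.
  by apply: filterS2 => h; rewrite /= !fctE /= => -> ; rewrite fgx.
have cdg : continuous ('d g x) by exact: diff_continuous.
have dfE : 'd f x = 'd g x :> (V -> W) by apply: diff_unique.
by split; [apply/diff_locallyP; rewrite dfE | exact: dfE].
Qed.

(** The induction on [k] passes from [f] to its derivative, which is constantly
[0] on [U]; the codomain and the value of the constant vary in the induction. *)
Lemma Ck_cst (k : nat) (E F : normedModType R) (U : set E) (f : E -> F) (a : F) :
  open U -> (forall x, U x -> f x = a) -> Ck k U f.
Proof.
move=> oU; have nearU x : U x -> \forall y \near x, U y.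
  by move=> Ux; apply: open_nbhs_nbhs.
elim: k F f a => [|k IH] F f a fa /=.
  move=> x Ux; have fx : \forall y \near x, a = f y.
    by apply: filterS (nearU _ Ux) => y /fa.
  rewrite /prop_for /continuous_at (fa _ Ux).
  by apply: cvg_trans (near_eq_cvg fx) _; exact: cvg_cst.
have df x : U x -> differentiable f x /\ 'd f x = 0 :> (E -> F).
  move=> Ux; have fx : \forall y \near x, f y = cst a y.
    by apply: filterS (nearU _ Ux) => y /fa.
  have [dfx ->] := near_eq_diff fx (differentiable_cst a x).
  by split; [exact: dfx | exact: diff_cst].
split=> [x /df[]//|].
apply: (IH _ _ 0) => x /df[dfx dfx0]; apply/val_inj.
by rewrite /= DmapE.
Qed.

(** The derivative is constantly the identity on [U], so that [Ck_cst] gives all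
higher derivatives. *)
Lemma smooth_on_id (E : normedModType R) (U : set E) (f : E -> E) :
  open U -> (forall x, U x -> f x = x) -> smooth_on U f.
Proof.
move=> oU fid.
have near_id x : U x -> \forall y \near x, f y = id y.
  by move=> Ux; apply: filterS (open_nbhs_nbhs (conj oU Ux)) => y /fid.
have df x : U x -> differentiable f x /\ 'd f x = id :> (E -> E).
  move=> Ux; have [dif val] := is_diff_id x.
  have [dfx ->] := near_eq_diff (near_id _ Ux) dif.
  by split; [exact: dfx | exact: val].
case=> [|k] /=.
  by move=> x /df[/differentiable_continuous].
split=> [x /df[]//|].
have idin : (id : E -> E) \in bop_pred E E.
  by rewrite unfold_in; apply: asboolT; split=> // x; exact: cvg_id.
apply: (@Ck_cst _ _ _ _ _ (Bop (@nonneg_lub_real R) idin)) => // x /df[dfx dfE].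
by apply/val_inj; rewrite /= DmapE.
Qed.

End Calculus.

(** * Charts and transition maps *)

Section Charts.
Context {R : realType} {M : topologicalType} {E : completeNormedModType R}.
Implicit Types (a b c d : chart M E) (A : set (chart M E)).

Lemma transitionE c d x : is_chart c -> chart_dom c x -> chart_dom d x ->
  transition c d (chart_map c x) = chart_map d x.
Proof.
move=> [_ inj _ _] cx dx; rewrite /transition.
case: xgetP => [z _ [x' [cx' _ xx' <-]]|/(_ (chart_map d x))[]].
  by congr chart_map; apply: inj; rewrite ?inE.
by exists x.
Qed.

Lemma overlap_open c d : is_chart c -> is_chart d -> open (overlap c d).
Proof.
move=> [oc _ _ opc] [od _ _ _]; apply: opc; first exact: openI.
by apply: subIsetl.
Qed.

(** The chain rule for [c \o a^-1 = (c \o b^-1) \o (b \o a^-1)], which holds on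
the image under [a] of the common domain of the three charts, a neighbourhood of
[a x]. *)
Lemma transition_comp a b c x :
    is_chart a -> is_chart b -> is_chart c ->
    chart_dom a x -> chart_dom b x -> chart_dom c x ->
    differentiable (transition a b) (chart_map a x) ->
    differentiable (transition b c) (chart_map b x) ->
  'd (transition a c) (chart_map a x) =
  'd (transition b c) (chart_map b x) \o 'd (transition a b) (chart_map a x)
    :> (E -> E).
Proof.
move=> ha hb hc ax bx cx dab dbc.
have tab : transition a b (chart_map a x) = chart_map b x by exact: transitionE.
have dbc' : differentiable (transition b c) (transition a b (chart_map a x)).
  by rewrite tab.
have near_comp : \forall y \near chart_map a x,
    transition a c y = (transition b c \o transition a b) y.
  pose D := chart_map a @` (chart_dom a `&` chart_dom b `&` chart_dom c).
  have oD : open D.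
    have [oa _ _ opa] := ha; have [ob _ _ _] := hb; have [oc _ _ _] := hc.
    apply: opa; first by apply: openI => //; exact: openI.
    by move=> y [[]].
  apply: (filterS (P := D)).
    by move=> _ [y [[ay by'] cy] <-] /=; rewrite !transitionE.
  by apply: open_nbhs_nbhs; split=> //; exists x.
have [_ acE] := near_eq_diff near_comp (differentiable_comp dab dbc').
rewrite -[in RHS]tab; exact: (etrans acE (diff_comp dab dbc')).
Qed.

Lemma compatible_diff c d x : compatible c d -> chart_dom c x -> chart_dom d x ->
  differentiable (transition c d) (chart_map c x).
Proof. by move=> [/(_ 1)[/= + _] _] cx dx; apply; exists x. Qed.

Lemma transition_id c x : is_chart c -> chart_dom c x ->
  'd (transition c c) (chart_map c x) = id :> (E -> E).
Proof.
move=> hc cx.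
have near_id : \forall y \near chart_map c x, transition c c y = id y.
  apply: (filterS (P := overlap c c)).
    by move=> _ [y [cy _] <-]; rewrite transitionE.
  by apply: open_nbhs_nbhs; split; [exact: overlap_open|exists x].
have [dif val] := is_diff_id (chart_map c x).
have [_ idE] := near_eq_diff near_id dif; exact: (etrans idE val).
Qed.

Lemma atlas_maximal A : is_atlas A -> A `<=` maximal_atlas A.
Proof. by move=> [ch _ comp] c Ac; split=> [|d Ad]; [exact: ch|exact: comp]. Qed.

End Charts.

(** * The tangent space *)

Section TangentSpace.
Context {R : realType} {M : topologicalType} {E : completeNormedModType R}.
Context (A : set (chart M E)) (p : M).

Lemma tangent_coord_continuous (c : chart_at A p) :
  continuous (fun v : tangent A p => v c).
Proof.
move=> v.
have cv : (tangent_val w : {ptws chart_at A p -> E}) @[w --> v] -->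
    (tangent_val v : {ptws chart_at A p -> E}).
  exact: (@initial_continuous _ {ptws chart_at A p -> E} (@tangent_val _ _ _ A p)).
have /cvg_sup/(_ c) cvc := cv.
move=> V Vc.
have /cvc := @initial_continuous _ _ (fun f : chart_at A p -> E => f c)
  (tangent_val v) _ Vc.
by apply; apply: fmap_filter; exact: nbhs_filter.
Qed.

(** The universal property of the initial topology of the coordinates. *)
Lemma continuous_to_tangent (T : topologicalType) (g : T -> tangent A p) :
  (forall c : chart_at A p, continuous (fun t => g t c)) -> continuous g.
Proof.
move=> cg; apply: continuous_comp_initial => t.
apply/cvg_sup => c V [_ /= [[W oW <-]] Wgtc WV].
apply: filterS WV _; apply: (cg c t).
exact: open_nbhs_nbhs.
Qed.

(** The isomorphism is the coordinate in the chart [c]; its inverse spreads a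
vector of [E] over all charts by the derivatives of the transitions from [c]. *)
Lemma tangent_iso (c : chart M E) : is_atlas A -> A c -> chart_dom c p ->
  toplinear_isomorphic (tangent A p) E.
Proof.
move=> atA Ac cp.
have mc : maximal_atlas A c by exact: atlas_maximal.
have hc : is_chart c by case: mc.
pose c0 : chart_at A p := exist _ c (conj mc cp).
have dcd (d : chart_at A p) : differentiable (transition c (sval d)) (chart_map c p).
  case: d => d [[_ md] dp] /=; apply: compatible_diff => //.
  by have [] := md _ Ac.
have ddc (d : chart_at A p) :
    differentiable (transition (sval d) c) (chart_map (sval d) p).
  case: d => d [[_ md] dp] /=; apply: compatible_diff => //.
  exact: md.
pose g0 (w : E) (d : chart_at A p) := 'd (transition c (sval d)) (chart_map c p) w.
have g0in w : g0 w \in (@tangent_pred _ _ _ A p).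
  rewrite unfold_in; apply: asboolT => d e.
  have hd : is_chart (sval d) by case: d => ? [[]].
  have he : is_chart (sval e) by case: e => ? [[]].
  have dp : chart_dom (sval d) p by case: d {hd} => ? [].
  have ep : chart_dom (sval e) p by case: e {he} => ? [].
  (* The transition from [d] to [e] factors through [c]. *)
  rewrite (transition_comp hd hc he) //= /g0.
  congr ('d _ _ _).
  (* Going from [c] to [d] and back is the identity. *)
  have := transition_comp hc hd hc cp dp cp (dcd d) (ddc d).
  by rewrite transition_id// => /(congr1 (fun f => f w)).
pose g w := Tangent (g0in w).
have gl : linear g.
  by move=> a u v; apply/val_inj/funext => d; rewrite /= /g0 linearP.
pose gL : {linear E -> tangent A p} := HB.pack g (GRing.isLinear.Build R _ _ _ g gl).
pose f (v : tangent A p) := v c0.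
have fl : linear f by [].
pose fL : {linear tangent A p -> E} := HB.pack f (GRing.isLinear.Build R _ _ _ f fl).
exists fL, gL; split.
- move=> v; apply/val_inj/funext => d /=; rewrite /g0 /f.
  by case: v => v vt; have /asboolW := vt => /(_ c0 d).
- by move=> w; rewrite /= /f /= /g0 /= transition_id.
- exact: tangent_coord_continuous.
- by apply: continuous_to_tangent => d; exact: diff_continuous.
Qed.

End TangentSpace.

(** * Open subsets of Banach spaces *)

Section OpenSubset.
Context {R : realType} {E : completeNormedModType R} (U : set E) (oU : open U).

Let c0 : chart U E := Chart setT (@set_val E U).

Lemma inclusion_is_chart : is_chart c0.
Proof.
split=> /=.
- exact: openT.
- by move=> x y _ _; exact: val_inj.
- by apply: continuous_subspaceT; exact: initial_continuous.
- move=> _ [W oW <-] _.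
  suff -> : set_val @` (@set_val E U @^-1` W) = W `&` U by exact: openI.
  apply/seteqP; split=> [_ [x Wx <-]|x [Wx Ux]].
    by split=> //; exact: set_mem (svalP x).
  by exists (SigSub (mem_set Ux)).
Qed.

Lemma inclusion_banach_manifold : banach_manifold (inclusion_atlas U).
Proof.
split.
  move=> x y cl; apply/val_inj.
  apply: (@norm_hausdorff _ E) => V W Vx Wy.
  have [z []] := cl _ _ (@initial_continuous _ _ (@set_val E U) x _ Vx)
    (@initial_continuous _ _ (@set_val E U) y _ Wy).
  by exists (set_val z).
split=> [_ ->|x|_ _ -> ->].
- exact: inclusion_is_chart.
- by exists c0.
- have sm : smooth_on (overlap c0 c0) (transition c0 c0).
    apply: smooth_on_id; first by apply: overlap_open; exact: inclusion_is_chart.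
    by move=> _ [x _ <-]; apply: transitionE => //; exact: inclusion_is_chart.
  by [].
Qed.

End OpenSubset.

(** * Invertible operators form an open set *)

(** The complex numbers [a] and [e] are real, being comparable to [0]; the
archimedean property is that of [R]. *)
Lemma half_powers_small (R : realType) (a e : R[i]) : 0 <= a -> 0 < e ->
  exists n, 2^-1 ^+ n * a < e.
Proof.
move=> a0 e0; have ae0 : 0 <= a / e by rewrite divr_ge0// ltW.
have aeE : a / e = (complex.Re (a / e))%:C by rewrite RRe_real ?ger0_real.
exists (Num.bound (complex.Re (a / e))).
set n := Num.bound _.
rewrite exprVn mulrC ltr_pdivrMr ?exprn_gt0// mulrC -ltr_pdivrMr//.
apply: (@lt_trans _ _ n%:R); last by rewrite -natrX ltr_nat ltn_expl.
rewrite aeE -(rmorph_nat (@real_complex R)) ltcR.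
by apply: archi_boundP; rewrite -lecR -aeE.
Qed.

Section Inverse.
Context {R : realType} {E F : completeNormedModType R[i]}.
Local Notation bop := (bop (@nonneg_lub_complex R)).

(** An operator that is bounded below has closed range, so that a dense range is
everything.  The preimage of [y] is the limit of the filter of approximate
solutions, generated by the sets [|y - T x| <= e]: it is Cauchy since [T] is
bounded below. *)
Lemma bounded_below_surj (T : bop E F) (m : R[i]) : 0 < m ->
    (forall x, `|x| <= m * `|T x|) ->
    (forall y e, 0 < e -> exists x, `|y - T x| <= e) ->
  forall y, exists x, T x = y.
Proof.
move=> m0 below dense y.
pose B e : set E := [set x | `|y - T x| <= e].
pose G := filter_from [set e : R[i] | 0 < e] B.
have PG : ProperFilter G.
  apply: filter_from_proper; last by move=> e /(dense y)[x xe]; exists x.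
  apply: filter_from_filter; first by exists 1; exact: ltr01.
  move=> e d /= e0 d0.
  have ed : (e >=< d)%R by rewrite real_comparable ?gtr0_real.
  exists (Order.min e d) => [|x]; first by rewrite /= minEle; case: ifP.
  rewrite /B /= comparable_le_min// => /andP[]; by split.
have cG : cauchy G.
  apply: cauchy_exP => e e0.
  have d0 : 0 < e / m / 3 by rewrite !divr_gt0.
  have [x xd] := dense y _ d0; exists x, (e / m / 3) => // z zd.
  rewrite -ball_normE /=; apply: le_lt_trans (below _) _.
  rewrite linearB mulrC -ltr_pdivlMr//.
  have -> : T x - T z = (y - T z) - (y - T x) by rewrite opprB [RHS]addrC addrA subrK.
  apply: le_lt_trans (ler_normB _ _) _; apply: le_lt_trans (lerD zd xd) _.
  have {3}-> : e / m = (e / m / 3) *+ 3 by rewrite -[RHS]mulr_natr divfK ?pnatr_eq0.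
  by rewrite -mulr2n ltr_pMn2l.
have /cvg_ex[x Gx] : cvg G by exact: cauchy_cvg.
exists x; apply/eqP; rewrite eq_sym -subr_eq0 -normr_le0.
apply/ler_addgt0Pr => e e0; rewrite add0r.
have e20 : 0 < e / 2 by rewrite divr_gt0.
have GT : \forall z \near G, `|T z - T x| <= e / 2.
  have : T z @[z --> G] --> T x by apply: cvg_comp Gx _; exact: bop_continuous.
  by move=> /cvgrPdistC_le; apply.
have GB : G (B (e / 2)) by exists (e / 2).
have [z [zT zB]] := filter_ex (filterI GT GB).
have -> : y - T x = (T z - T x) + (y - T z) by rewrite [RHS]addrC addrA subrK.
rewrite (splitr e); apply: le_trans (ler_normD _ _) _; exact: lerD.
Qed.

(** The lower bound gives both the injectivity of [T] and the continuity of its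
inverse. *)
Lemma bounded_below_inverse (T : bop E F) (m : R[i]) : 0 < m ->
    (forall x, `|x| <= m * `|T x|) -> (forall y, exists x, T x = y) ->
  exists S : bop F E, cancel T S /\ cancel S T.
Proof.
move=> m0 below surj.
have Tinj : injective T.
  move=> x x' Txx'; apply/eqP; rewrite -subr_eq0 -normr_le0.
  have T0 : T (x - x') = 0.
    by rewrite linearB; apply/eqP; rewrite subr_eq0; apply/eqP.
  by apply: le_trans (below _) _; rewrite T0 normr0 mulr0.
have [S ST] := choice surj.
have TS : cancel T S by move=> x; apply: Tinj; rewrite ST.
have Sl : linear S.
  by move=> a u v; apply: Tinj; rewrite bop_linear !ST.
pose Sf : {linear F -> E} := HB.pack S (GRing.isLinear.Build R[i] _ _ _ S Sl).
have Sc : continuous S.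
  apply: (@bounded_linear_continuous _ _ _ Sf).
  apply/linear_boundedP; near=> r => y /=.
  apply: le_trans (below _) _; rewrite ST ler_wpM2r//; near: r.
  by apply: nbhs_pinfty_ge; rewrite gtr0_real.
have Sin : S \in bop_pred F E by rewrite unfold_in; apply: asboolT.
by exists (Bop (@nonneg_lub_complex R) Sin); split; [exact: TS | exact: ST].
Unshelve. all: by end_near. Qed.

(** The Neumann series argument, for the contraction constant [1/2]. *)
Lemma perturb_inverse (L T : bop E F) (S : bop F E) :
    cancel L S -> cancel S L -> `|S| * `|T - L| <= 2^-1 ->
  exists S' : bop F E, cancel T S' /\ cancel S' T.
Proof.
move=> LS SL small.
(* The summand [1] keeps the constant positive when [S = 0]. *)
have m0 : 0 < 2 * (`|S| + 1) by rewrite mulr_gt0// ltr_wpDl.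
have STL x : `|S ((T - L) x)| <= 2^-1 * `|x|.
  apply: le_trans (bop_normP _ _) _.
  apply: le_trans (ler_wpM2l (normr_ge0 S) (bop_normP (T - L) x)) _.
  by rewrite mulrA ler_wpM2r.
have below x : `|x| <= 2 * (`|S| + 1) * `|T x|.
  suff : `|x| <= `|S| * `|T x| + 2^-1 * `|x|.
    rewrite -lerBlDr -{1}[`|x|]mul1r -mulrBl {1}(splitr 1) div1r addrK.
    rewrite -ler_pdivlMl// invrK => /le_trans; apply.
    by rewrite -mulrA ler_wpM2l// ler_wpM2r// lerDl.
  have {1}-> : x = S (T x) - S ((T - L) x).
    have TLx : T x - (T - L) x = L x by rewrite bopBE opprB addrC subrK.
    by rewrite -{1}(LS x) -TLx linearB.
  apply: le_trans (ler_normB _ _) _; apply: lerD (STL x).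
  exact: bop_normP.
apply: (bounded_below_inverse m0 below); apply: (bounded_below_surj m0 below).
move=> y e e0.
(* Replacing [x] by [x + S r], for the residual [r = y - T x], turns [r] into
   [- (T - L) (S r)]. *)
have approx n : exists x, `|y - T x| <= 2^-1 ^+ n * `|y|.
  elim: n => [|n [x xn]]; first by exists 0; rewrite linear0 subr0 expr0 mul1r.
  exists (x + S (y - T x)).
  have -> : y - T (x + S (y - T x)) = - (T - L) (S (y - T x)).
    by rewrite bopBE SL linearD opprB opprD addrA.
  rewrite normrN exprS -mulrA.
  apply: le_trans (bop_normP _ _) _.
  apply: le_trans (ler_wpM2l (normr_ge0 (T - L)) (bop_normP S _)) _.
  rewrite [leLHS]mulrA [X in X * _ <= _]mulrC.
  by apply: ler_pM; rewrite ?mulr_ge0.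
have [n /ltW ne] := half_powers_small (normr_ge0 y) e0.
by have [x /le_trans xe] := approx n; exists x; exact: xe.
Qed.

End Inverse.

(** * Positive isomorphisms form an open set *)

Section PositiveOperators.
Context {R : realType} {H : hilbertType R}.
Implicit Types (L T : operator H) (x : H).

Lemma positive_op_ge0 T x : positive_op T -> 0 <= inner (T x) x.
Proof.
move=> [_ pT]; have [->|x0] := eqVneq x 0; first by rewrite linear0r.
have nx : 0 < `|x|^-1 by rewrite invr_gt0 normr_gt0.
apply/ltW; have := pT (`|x|^-1 *: x) (normfZV x0).
have -> : T (`|x|^-1 *: x) = `|x|^-1 *: T x by exact: linearZ.
by rewrite linearZl_LR linearZr_LR /= geC0_conj ?(ltW nx)// !pmulr_rgt0.
Qed.

(** Positivity alone only bounds [<Tx, x>] below by [0]; invertibility makes the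
bound uniform.  The key estimate [|T x|^2 <= M <Tx, x>] comes from the
positivity of [T] at [x - M^-1 T x], where [M] is slightly larger than [|T|]. *)
Lemma positive_iso_coercive T : isomorphism T -> positive_op T ->
  exists2 c : R[i], 0 < c & forall x, c * `|x| ^+ 2 <= inner (T x) x.
Proof.
move=> [S [TS _]] pT; have [saT _] := pT.
pose M := `|T| + 1; pose N := `|S| + 1.
have M0 : 0 < M by rewrite ltr_wpDl.
have N0 : 0 < N by rewrite ltr_wpDl.
exists (M^-1 * N^-1 ^+ 2) => [|x]; first by rewrite mulr_gt0 ?exprn_gt0 ?invr_gt0.
apply: (@le_trans _ _ (M^-1 * `|T x| ^+ 2)).
  rewrite -mulrA ler_wpM2l ?invr_ge0 ?(ltW M0)// -exprMn.
  rewrite lerXn2r ?nnegrE ?mulr_ge0 ?invr_ge0 ?(ltW N0)//.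
  rewrite ler_pdivrMl// -{1}(TS x) (le_trans (bop_normP _ _))//.
  by rewrite ler_wpM2r// lerDl.
have := positive_op_ge0 (x - M^-1 *: T x) pT.
have Mr : Num.conj M^-1 = M^-1 by rewrite geC0_conj// invr_ge0 ltW.
set y := T x.
(* The cross terms agree because [T] is self-adjoint. *)
have -> : inner (T (x - M^-1 *: y)) (x - M^-1 *: y) =
    inner y x - (M^-1 * `|y| ^+ 2) *+ 2 + M^-1 ^+ 2 * inner (T y) y.
  have -> : T (x - M^-1 *: y) = y - M^-1 *: T y.
    by rewrite [LHS]linearB [in LHS]linearZ.
  rewrite linearBl !linearBr 2!linearZl_LR 2!linearZr_LR /=.
  rewrite Mr saT -/y -inner_norm.
  rewrite opprB addrA mulrA -expr2 mulr2n opprD !addrA.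
  by rewrite addrAC -!addrA; do 2 congr (_ + _).
have Ty : M^-1 ^+ 2 * inner (T y) y <= M^-1 * `|y| ^+ 2.
  rewrite expr2 -mulrA ler_wpM2l ?invr_ge0 ?(ltW M0)// ler_pdivrMl//.
  apply: le_trans (real_ler_norm _) _; first by rewrite ger0_real// positive_op_ge0.
  apply: le_trans (inner_CauchySchwarz _ _) _.
  rewrite expr2 mulrA ler_wpM2r// (le_trans (bop_normP _ _))//.
  by rewrite ler_wpM2r// lerDl.
move=> ge0; rewrite -subr_ge0; apply: le_trans ge0 _.
by rewrite mulr2n opprD addrA -[leRHS]addr0 -[leLHS]addrA lerD2l addrC subr_le0.
Qed.

(** The order of [R[i]] is partial, so that [<Tx, x>] has to be shown real first,
which is where self-adjointness enters. *)
Lemma coercive_perturb L T (c : R[i]) : selfadjoint T ->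
    (forall x, c * `|x| ^+ 2 <= inner (L x) x) -> `|T - L| < c ->
  positive_op T.
Proof.
move=> saT coerL TL; split=> // x x1.
have c0 : 0 < c by apply: le_lt_trans TL.
have cr : c \is Num.real by rewrite gtr0_real.
have cL : c <= inner (L x) x by have := coerL x; rewrite x1 expr1n mulr1.
have Tr : inner (T x) x \is Num.real.
  apply/CrealP; rewrite [RHS]hermC /= expr0 mul1r.
  by congr (Num.conj _); exact: saT.
have Dr : inner ((T - L) x) x \is Num.real.
  by rewrite bopBE linearBl rpredB// ger0_real// (le_trans (ltW c0)).
have D : `|inner ((T - L) x) x| < c.
  apply: le_lt_trans (inner_CauchySchwarz _ _) _; rewrite x1 mulr1.
  by apply: le_lt_trans (bop_normP _ _) _; rewrite x1 mulr1.
have -> : inner (T x) x = inner ((T - L) x) x + inner (L x) x.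
  by rewrite bopBE linearBl subrK.
rewrite -[_ + _]opprK oppr_gt0 opprD subr_lt0.
apply: lt_le_trans cL; apply: le_lt_trans D.
by rewrite -normrN real_ler_norm// rpredN.
Qed.

(** The norm of [L_S(H)] is [R]-valued, whereas that of [L(H)], in which the
estimates are made, is [R[i]]-valued. *)
Lemma near_sa_dist (L : sa_operator H) (e : R[i]) : 0 < e ->
  \forall T \near L, `|sa_val T - sa_val L| < e.
Proof.
move=> e0; have eE : e = (complex.Re e)%:C by rewrite RRe_real ?gtr0_real.
have re0 : 0 < complex.Re e by rewrite -ltcR -eE.
apply/nbhs_normP; exists (complex.Re e) => //= T LT.
by rewrite distrC -[_ - _]/(sa_val (L - T)) -sa_normCE eE ltcR.
Qed.

Lemma GLSp_open : open (GLSp H).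
Proof.
rewrite openE => L [isoL posL].
have [c c0 coerL] := positive_iso_coercive isoL posL.
have [S [LS SL]] := isoL.
have N0 : 0 < 2^-1 / (`|S| + 1) by rewrite divr_gt0// ltr_wpDl.
have := near_sa_dist L c0; apply: filterS2 (near_sa_dist L N0) => T.
rewrite ltr_pdivlMr ?ltr_wpDl// => TLS TLc; split.
  apply: (perturb_inverse LS SL); apply: le_trans (ltW TLS).
  by rewrite mulrC ler_wpM2l// lerDl.
exact: (coercive_perturb (sa_operatorP T) coerL TLc).
Qed.

End PositiveOperators.

Theorem mainTheorem3 (R : realType) (H : hilbertType R) :
  open (GLSp H) /\
  banach_manifold (inclusion_atlas (GLSp H)) /\
  (forall L : set_type (GLSp H),
     toplinear_isomorphic (tangent (inclusion_atlas (GLSp H)) L) (sa_operator H)).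
Proof.
have oGL := @GLSp_open R H.
have mGL := inclusion_banach_manifold oGL.
split=> //; split=> // L.
have [_ atGL] := mGL.
by apply: (tangent_iso atGL (c := Chart setT (@set_val _ (GLSp H)))).
Qed.
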